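(* Using the conditions (CON), (ABS), (BREQ), (BND), (SG1), (FSML) on a pair $(f,g)$ (a function $f$ to be minimized and a gradient estimator $g$ of $\nabla f$) defined in the context, the following relations hold. (i) There is a minimization problem (a pair $(f,g)$) for which (CON) is satisfied but (ABS) is not; and there is one for which (ABS) is satisfied but (CON) is not. (ii) There is a minimization problem for which (CON) is satisfied but (BREQ) is not; and there is one for which (BREQ) is satisfied but (CON) is not. (iii) There is a minimization problem for which (BREQ) is satisfied but (ABS) is not; and there is one for which (ABS) is satisfied but (BREQ) is not. (iv) There is a minimization problem for which (BREQ) is satisfied but (BND) is not; and there is one for which (BND) is satisfied but (BREQ) is not. (v) There is a minimization problem for which (SG1) is satisfied but (BND) is not; and there is one for which (BND) is satisfied but (SG1) is not. (vi) There is a minimization problem for which (ABS) is satisfied but (FSML) is not; and there is one for which (FSML) is satisfied but (ABS) is not.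
   Context: $f:\mathbb{R}^d\to\mathbb{R}$ is a differentiable function (the objective of a minimization problem). A gradient estimator $g$ is a (possibly random) mapping $g:\mathbb{R}^d\to\mathbb{R}^d$; $\mathbb{E}[g(x)]$ need not equal $\nabla f(x)$. The expectation is over the randomness of $g$ at fixed $x$, and $\|\cdot\|$ is the Euclidean norm. A pair $(f,g)$ satisfies: (SG1) if there are $\alpha,\beta>0$ such that for all $x\in\mathbb{R}^d$: $\alpha\|\nabla f(x)\|^2\le \mathbb{E}[\|g(x)\|^2]\le \beta\langle \mathbb{E}[g(x)],\nabla f(x)\rangle$. (CON) if there is $\delta>0$ such that for all $x$: $\mathbb{E}[\|g(x)-\nabla f(x)\|^2]\le (1-\frac1\delta)\|\nabla f(x)\|^2$. (BREQ) (a condition on deterministic estimators only, so a genuinely random estimator does not satisfy it) if $g$ is deterministic and there are constants $\rho,\zeta\ge 0$ such that for all $x$: $\langle g(x),\nabla f(x)\rangle\ge\rho\|\nabla f(x)\|^2$ and $\|g(x)\|^2\le\zeta\|\nabla f(x)\|^2$. (BND) if there are constants $M,\sigma^2,\varphi^2\ge 0$ and $0\le m<1$ such that for all $x$: $\mathbb{E}[\|g(x)-\mathbb{E}[g(x)]\|^2]\le M\|\mathbb{E}[g(x)]\|^2+\sigma^2$ and $\|\mathbb{E}[g(x)]-\nabla f(x)\|^2\le m\|\nabla f(x)\|^2+\varphi^2$. (ABS) if there is $\Delta\ge0$ such that for all $x$: $\mathbb{E}[\|g(x)-\nabla f(x)\|^2]\le\Delta^2$. (FSML) if there are constants $0<q\le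 u$, $U\ge0$, $Q\ge0$ such that for all $x$: $\langle\nabla f(x),\mathbb{E}[g(x)]\rangle\ge q\|\nabla f(x)\|^2$, $\|\mathbb{E}[g(x)]\|\le u\|\nabla f(x)\|$, and $\mathbb{E}[\|g(x)-\mathbb{E}[g(x)]\|^2]\le U\|\nabla f(x)\|^2+Q$. *)

(* Defs.v *)
From HB Require Import structures.
From mathcomp Require Import all_boot all_order all_algebra.
From mathcomp Require Import all_classical all_reals all_analysis.

Set Implicit Arguments.
Unset Strict Implicit.
Unset Printing Implicit Defensive.

Import Order.TTheory GRing.Theory Num.Theory.
Import numFieldNormedType.Exports.

Local Open Scope classical_set_scope.
Local Open Scope ring_scope.

(* The library's norm on 'rV[R]_d is the sup norm, hence the explicit Euclidean
   structure. The topology, and so differentiability, is the same for both. *)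
Definition dotp (R : realType) (d : nat) (u v : 'rV[R]_d) : R :=
  \sum_(i < d) u 0 i * v 0 i.

Definition enorm (R : realType) (d : nat) (u : 'rV[R]_d) : R :=
  Num.sqrt (dotp u u).

Definition grad (R : realType) (d : nat) (f : 'rV[R]_d -> R) (x : 'rV[R]_d) :
    'rV[R]_d :=
  \row_(i < d) 'D_(delta_mx 0 i) f x.

(* A pair (f, g). The estimator is a random vector [estimator w x] for each fixed
   x; no regularity in x is imposed. Integrability of its coordinates makes
   E[g(x)] meaningful. Second moments are not assumed finite: they are
   extended reals in the conditions below. *)
Record min_problem (R : realType) (d : nat) := MinProblem {
  objective : 'rV[R]_d -> R ;
  objective_differentiable : forall x, differentiable objective x ;
  sample_display : measure_display ;
  sample_space : measurableType sample_display ;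
  sample_law : probability sample_space R ;
  estimator : sample_space -> 'rV[R]_d -> 'rV[R]_d ;
  estimator_integrable : forall (x : 'rV[R]_d) (i : 'I_d),
    sample_law.-integrable [set: sample_space]
      (fun w => (estimator w x 0 i)%:E)
}.

Section Conditions.
Variables (R : realType) (d : nat) (p : min_problem R d).

Local Notation P := (@sample_law R d p).
Local Notation g := (@estimator R d p).

Definition gradf (x : 'rV[R]_d) : 'rV[R]_d := grad (@objective R d p) x.

Definition est_mean (x : 'rV[R]_d) : 'rV[R]_d :=
  \row_(i < d) fine 'E_P[(fun w => g w x 0 i)%R]%E.

Definition second_moment (x : 'rV[R]_d) : \bar R :=
  'E_P[(fun w => enorm (g w x) ^+ 2)%R]%E.

Definition mean_sq_error (x : 'rV[R]_d) : \bar R :=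
  'E_P[(fun w => enorm (g w x - gradf x) ^+ 2)%R]%E.

Definition est_variance (x : 'rV[R]_d) : \bar R :=
  'E_P[(fun w => enorm (g w x - est_mean x) ^+ 2)%R]%E.

Definition SG1 : Prop :=
  exists alpha beta : R, [/\ 0 < alpha, 0 < beta &
    forall x : 'rV[R]_d,
      ((alpha * enorm (gradf x) ^+ 2)%:E <= second_moment x)%E /\
      (second_moment x <= (beta * dotp (est_mean x) (gradf x))%:E)%E].

Definition CON : Prop :=
  exists delta : R, 0 < delta /\
    forall x : 'rV[R]_d,
      (mean_sq_error x <= ((1 - delta^-1) * enorm (gradf x) ^+ 2)%:E)%E.

(* "Deterministic" means almost surely equal, at every x, to a fixed map h. *)
Definition BREQ : Prop :=
  exists h : 'rV[R]_d -> 'rV[R]_d,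
    (forall x : 'rV[R]_d, {ae P, forall w, g w x = h x}) /\
    exists rho zeta : R, [/\ 0 <= rho, 0 <= zeta &
      forall x : 'rV[R]_d,
        rho * enorm (gradf x) ^+ 2 <= dotp (h x) (gradf x) /\
        enorm (h x) ^+ 2 <= zeta * enorm (gradf x) ^+ 2].

(* sigma2 and phi2 are the constants usually written sigma^2 and phi^2. *)
Definition BND : Prop :=
  exists M sigma2 phi2 m : R,
    [/\ 0 <= M, 0 <= sigma2, 0 <= phi2, 0 <= m < 1 &
      forall x : 'rV[R]_d,
        (est_variance x <= (M * enorm (est_mean x) ^+ 2 + sigma2)%:E)%E /\
        enorm (est_mean x - gradf x) ^+ 2 <= m * enorm (gradf x) ^+ 2 + phi2].

Definition ABS : Prop :=
  exists Delta : R, 0 <= Delta /\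
    forall x : 'rV[R]_d, (mean_sq_error x <= (Delta ^+ 2)%:E)%E.

Definition FSML : Prop :=
  exists q u U Q : R, [/\ 0 < q <= u, 0 <= U, 0 <= Q &
    forall x : 'rV[R]_d,
      [/\ q * enorm (gradf x) ^+ 2 <= dotp (gradf x) (est_mean x),
          enorm (est_mean x) <= u * enorm (gradf x) &
          (est_variance x <= (U * enorm (gradf x) ^+ 2 + Q)%:E)%E]].

End Conditions.

(* Main.v *)
From HB Require Import structures.
Require Import Defs.
From mathcomp Require Import all_boot all_order all_algebra.
From mathcomp Require Import all_classical all_reals all_analysis.
From mathcomp Require Import ring lra.

(* With [f x = |x|^2 / 2], whose gradient at [x] is [x], three estimators
   separate all the conditions: [x + e] for a unit vector [e] (bounded error, but
   nonzero at the critical point), [3 x] (proportional to the gradient, but with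
   relative error 2), and the random one equal to [x] or [0] with equal
   probability (relative mean square error 1/2, but not deterministic). *)

Set Implicit Arguments.
Unset Strict Implicit.
Unset Printing Implicit Defensive.

Import Order.TTheory GRing.Theory Num.Theory.
Import numFieldNormedType.Exports.

Local Open Scope classical_set_scope.
Local Open Scope ring_scope.

(** * Euclidean inner product and the gradient of half the squared norm *)

Section EuclideanStructure.
Variables (R : realType) (d : nat).
Implicit Types (u v x : 'rV[R]_d) (a : R).

Lemma dotp_ge0 u : 0 <= dotp u u.
Proof. by apply: sumr_ge0 => i _; rewrite -expr2 sqr_ge0. Qed.

Lemma enorm_sqr u : enorm u ^+ 2 = dotp u u.
Proof. by rewrite sqr_sqrtr ?dotp_ge0. Qed.

Lemma dotpZl a u v : dotp (a *: u) v = a * dotp u v.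
Proof.
by rewrite /dotp mulr_sumr; apply: eq_bigr => i _; rewrite mxE mulrA.
Qed.

Lemma dotpZr a u v : dotp u (a *: v) = a * dotp u v.
Proof.
by rewrite /dotp mulr_sumr; apply: eq_bigr => i _; rewrite mxE mulrCA.
Qed.

Lemma dotp0r u : dotp u 0 = 0.
Proof. by rewrite -(scale0r 0) dotpZr mul0r. Qed.

Lemma dotp_delta (i : 'I_d) : dotp (delta_mx 0 i) (delta_mx 0 i) = 1 :> R.
Proof.
rewrite /dotp (bigD1 i) //= mxE !eqxx mulr1 big1 ?addr0 // => j ji.
by rewrite mxE (negbTE ji) mulr0.
Qed.

(** A scaled sum of squared coordinate functions is the form to which the differentiation rules for
    sums, powers and scalings apply. *)
Lemma half_dotpE : (fun x => 2^-1 * dotp x x) =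
  2^-1 \*: \sum_(i < d) (fun x : 'rV[R]_d => x 0 i) ^+ 2.
Proof.
by apply/funext => x /=; rewrite fct_sumE; congr (_ * _).
Qed.

(** A coordinate is linear and continuous, so it is its own differential; packing it as the linear
    map [l] makes [diff_lin] applicable. *)
Lemma is_derive_coord (i : 'I_d) x v :
  is_derive x v (fun y : 'rV[R]_d => y 0 i) (v 0 i).
Proof.
apply: DeriveDef; first exact/diff_derivable/differentiable_coord.
have coord_linear : linear (fun y : 'rV[R]_d => y 0 i : R^o).
  by move=> a u w; rewrite !mxE.
pose l : {linear _ -> _} := HB.pack (fun y : 'rV[R]_d => y 0 i : R^o)
  (GRing.isLinear.Build _ _ _ _ _ coord_linear).
rewrite deriveE; last exact: differentiable_coord.
have -> : (fun y : 'rV[R]_d => y 0 i) = l :> (_ -> _) by [].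
by rewrite diff_lin //; exact: coord_continuous.
Qed.

Lemma differentiable_half_dotp x :
  differentiable (fun y => 2^-1 * dotp y y) x.
Proof.
rewrite half_dotpE; apply: differentiableZ; apply: differentiable_sum => i.
by apply: differentiableX; exact: differentiable_coord.
Qed.

Lemma grad_half_dotp x : grad (fun y => 2^-1 * dotp y y) x = x.
Proof.
apply/rowP => i; rewrite mxE half_dotpE.
pose v : 'rV[R]_d := delta_mx 0 i; rewrite -/v.
have dX j : is_derive x v ((fun y : 'rV[R]_d => y 0 j) ^+ 2)
    (2 * x 0 j * v 0 j).
  have cj := is_derive_coord j x v.
  by apply: is_derive_eq; rewrite expr1.
have [_ ->] := is_deriveZ 2^-1 (is_derive_sum dX).
(* In the direction of the [i]-th basis vector only the [i]-th square varies. *)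
rewrite (bigD1 i) //= big1 => [|j ji]; last by rewrite mxE (negbTE ji) mulr0.
by rewrite mxE !eqxx addr0 /GRing.scale /=; field.
Qed.

End EuclideanStructure.

Lemma expectation_eq_cst disp (T : measurableType disp) (R : realType)
  (P : probability T R) (X : T -> R) (r : R) :
  (forall w, X w = r) -> 'E_P[X]%E = r%:E.
Proof.
by move=> Xr; rewrite -(expectation_cst P); congr expectation; exact/funext.
Qed.

(** * The quadratic objective with an estimator driven by a fair coin *)

Section QuadraticProblem.
Variables (R : realType) (d : nat).
Implicit Types (g : bool -> 'rV[R]_d -> 'rV[R]_d) (h : 'rV[R]_d -> 'rV[R]_d).

Let half : 0 <= (2^-1 : R) <= 1.
Proof. by apply/andP; split; lra. Qed.

Let onem_half : unstable.onem (2^-1 : R) = 2^-1.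
Proof. by rewrite /unstable.onem; field. Qed.

(** On two points the integral is a finite sum of reals. *)
Lemma integrable_bernoulli (F : bool -> R) :
  (bernoulli_prob 2^-1).-integrable [set: bool] (EFin \o F).
Proof.
apply/integrableP; split => //.
by rewrite integral_bernoulli_prob // -!EFinM -EFinD ltry.
Qed.

(** One coin space serves all the examples; a deterministic estimator ignores the outcome. *)
Definition quad_problem g : min_problem R d :=
  MinProblem (@differentiable_half_dotp R d)
    (fun x i => integrable_bernoulli (fun w => g w x 0 i)).

Lemma gradf_quad g x : gradf (quad_problem g) x = x.
Proof. exact: grad_half_dotp. Qed.

Lemma est_mean_det h x : est_mean (quad_problem (fun=> h)) x = h x.
Proof.
by apply/rowP => i; rewrite mxE (@expectation_eq_cst _ _ _ _ _ (h x 0 i)).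
Qed.

Lemma second_moment_det h x :
  second_moment (quad_problem (fun=> h)) x = (dotp (h x) (h x))%:E.
Proof. by apply: expectation_eq_cst => w; rewrite enorm_sqr. Qed.

Lemma mean_sq_error_det h x :
  mean_sq_error (quad_problem (fun=> h)) x = (dotp (h x - x) (h x - x))%:E.
Proof. by apply: expectation_eq_cst => w; rewrite enorm_sqr gradf_quad. Qed.

Lemma est_variance_det h x : est_variance (quad_problem (fun=> h)) x = 0%E.
Proof.
apply: expectation_eq_cst => w.
by rewrite est_mean_det /= subrr enorm_sqr dotp0r.
Qed.

Lemma mean_sq_error_coin g x : mean_sq_error (quad_problem g) x =
  (2^-1 * (dotp (g true x - x) (g true x - x) +
           dotp (g false x - x) (g false x - x)))%:E.
Proof.
rewrite /mean_sq_error unlock integral_bernoulli_prob //=; last first.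
  by move=> w; rewrite lee_fin sqr_ge0.
by rewrite !enorm_sqr gradf_quad onem_half -!EFinM -EFinD mulrDr.
Qed.

(** Each outcome has mass 1/2, so a null set contains neither of them. *)
Lemma ae_bernoulli_half (Q : bool -> Prop) :
  {ae (bernoulli_prob 2^-1 : probability bool R), forall w, Q w} ->
  forall w, Q w.
Proof.
move=> [A [mA A0 hA]] w; apply: contrapT => Qw.
have Aw : A w by exact: hA.
move: A0; rewrite /= bernoulli_probE // onem_half => /eqP.
rewrite padde_eq0 ?mule_ge0 ?lee_fin ?invr_ge0 // !diracE.
have half_neq0 : (2^-1 : R)%:E != 0%E by rewrite eqe invr_eq0 pnatr_eq0.
by case: w Qw Aw => _ /mem_set ->; rewrite mule1 (negbTE half_neq0) ?andbF.
Qed.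

End QuadraticProblem.

(** * The three separating estimators *)

Section Examples.
Variables (R : realType) (d : nat) (e : 'rV[R]_d).
Hypothesis e1 : dotp e e = 1.

Definition shifted := quad_problem (fun=> fun x => x + e).
(** The squared error is 4 times the squared gradient norm, whereas [CON], and [BND] up to an
    additive constant, allow only a factor below 1. *)
Definition tripled := @quad_problem R d (fun=> fun x => 3 *: x).
Definition masked := @quad_problem R d (fun w x => if w then x else 0).

Lemma dotp_scaled (a : R) : dotp (a *: e) (a *: e) = a ^+ 2.
Proof. by rewrite dotpZl dotpZr e1 mulr1 expr2. Qed.

Lemma tripled_error x : mean_sq_error tripled x = (4 * dotp x x)%:E.
Proof.
rewrite mean_sq_error_det; congr (_%:E).
have -> : 3 *: x - x = 2 *: x by apply/rowP => i; rewrite !mxE; ring.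
by rewrite dotpZl dotpZr; ring.
Qed.

Lemma masked_error x : mean_sq_error masked x = (2^-1 * dotp x x)%:E.
Proof.
rewrite mean_sq_error_coin subrr dotp0r add0r sub0r -scaleN1r dotpZl dotpZr.
by congr (_%:E); ring.
Qed.

Lemma ABS_shifted : ABS shifted.
Proof.
exists 1; split=> // x.
by rewrite mean_sq_error_det addrAC subrr add0r e1 expr1n.
Qed.

Lemma BND_shifted : BND shifted.
Proof.
(* The variance is 0 and the squared bias is exactly 1, which [phi2] absorbs. *)
exists 0, 0, 1, 0; split=> //; first by rewrite lexx ltr01.
move=> x; rewrite est_variance_det est_mean_det gradf_quad.
by rewrite addrAC subrr add0r !enorm_sqr e1 !mul0r !add0r.
Qed.

(** At the critical point 0 the bound vanishes with the gradient, while the estimator is still the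
    unit vector [e]. The same point refutes [BREQ], [SG1] and [FSML]. *)
Lemma not_CON_shifted : ~ CON shifted.
Proof.
case=> delta [_ /(_ 0)].
rewrite mean_sq_error_det gradf_quad subr0 add0r e1 enorm_sqr dotp0r mulr0.
by rewrite lee_fin ler10.
Qed.

Lemma not_BREQ_shifted : ~ BREQ shifted.
Proof.
case=> h [hg [rho [zeta [_ _ /(_ 0)[_]]]]].
(* Almost sure equality holds at the outcome [true], hence [h 0] is [e]. *)
rewrite -(ae_bernoulli_half (hg 0) true) gradf_quad /= add0r !enorm_sqr.
by rewrite e1 dotp0r mulr0 ler10.
Qed.

Lemma not_SG1_shifted : ~ SG1 shifted.
Proof.
case=> alpha [beta [_ _ /(_ 0)[_]]].
rewrite second_moment_det gradf_quad add0r e1 dotp0r mulr0.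
by rewrite lee_fin ler10.
Qed.

Lemma not_FSML_shifted : ~ FSML shifted.
Proof.
case=> q [u [U [Q [_ _ _ /(_ 0)[_ + _]]]]].
rewrite est_mean_det gradf_quad add0r /enorm e1 dotp0r sqrtr1 sqrtr0 mulr0.
by rewrite ler10.
Qed.

Lemma BREQ_tripled : BREQ tripled.
Proof.
exists (fun x => 3 *: x); split; first by move=> x; exact: aeW.
exists 3, 9; split=> // x.
by rewrite gradf_quad !enorm_sqr dotpZl; split=> //; rewrite dotpZl dotpZr; lra.
Qed.

Lemma SG1_tripled : SG1 tripled.
Proof.
(* Both bounds are equalities: the second moment is 9 times the squared norm of [x], and the inner
   product is 3 times it. *)
exists 9, 3; split=> // x.
rewrite second_moment_det est_mean_det gradf_quad enorm_sqr !dotpZl dotpZr.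
by rewrite !lee_fin; split; lra.
Qed.

Lemma FSML_tripled : FSML tripled.
Proof.
exists 3, 3, 0, 0; split=> //; first by rewrite ltr0n lexx.
move=> x; rewrite est_variance_det est_mean_det gradf_quad mul0r addr0.
split=> //; first by rewrite enorm_sqr dotpZr.
rewrite /enorm dotpZl dotpZr mulrA -expr2 sqrtrM ?sqr_ge0 //.
by rewrite sqrtr_sqr ger0_norm.
Qed.

Lemma not_CON_tripled : ~ CON tripled.
Proof.
case=> delta [d0 /(_ e)].
rewrite tripled_error gradf_quad enorm_sqr e1 lee_fin !mulr1.
(* At [e] the condition reads 4 <= 1 - 1/delta, impossible for positive [delta]. *)
by have := invr_gt0 delta; rewrite d0; lra.
Qed.

Lemma not_ABS_tripled : ~ ABS tripled.
Proof.
(* The error there is 4 (D + 1)^2, above D^2. *)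
case=> D [D0 /(_ ((D + 1) *: e))].
by rewrite tripled_error dotp_scaled lee_fin; nra.
Qed.

Lemma not_BND_tripled : ~ BND tripled.
Proof.
(* With t = p2 + 1 the squared bias is 4 t^2, while the bound m t^2 + p2 stays below t^2 + t. *)
case=> M [s2 [p2 [m [_ _ p0 /andP[m0 m1] /(_ ((p2 + 1) *: e))[_]]]]].
rewrite est_mean_det gradf_quad !enorm_sqr.
set x := (p2 + 1) *: e.
have -> : 3 *: x - x = 2 *: x by apply/rowP => i; rewrite !mxE; ring.
by rewrite dotpZl dotpZr dotp_scaled; nra.
Qed.

Lemma CON_masked : CON masked.
Proof.
(* The factor 1 - 1/2 is exactly the relative error. *)
exists 2; split=> // x.
by rewrite masked_error gradf_quad enorm_sqr lee_fin; lra.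
Qed.

Lemma not_ABS_masked : ~ ABS masked.
Proof.
(* The coefficient 2 outweighs the factor 1/2 of the error: (2 D + 1)^2 / 2 exceeds D^2. *)
case=> D [D0 /(_ ((2 * D + 1) *: e))].
by rewrite masked_error dotp_scaled lee_fin; nra.
Qed.

(** A deterministic value at [e] would have to equal both outcomes, [e] and 0. *)
Lemma not_BREQ_masked : ~ BREQ masked.
Proof.
case=> h [/(_ e)/ae_bernoulli_half he _].
have e0 : e = 0 by exact: etrans (he true) (esym (he false)).
by move/eqP: e1; rewrite e0 dotp0r eq_sym oner_eq0.
Qed.

End Examples.

Theorem theorem1 (R : realType) (d : nat) (hd : (0 < d)%N) :
  ((exists p : min_problem R d, CON p /\ ~ ABS p) /\
   (exists p : min_problem R d, ABS p /\ ~ CON p)) /\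
  ((exists p : min_problem R d, CON p /\ ~ BREQ p) /\
   (exists p : min_problem R d, BREQ p /\ ~ CON p)) /\
  ((exists p : min_problem R d, BREQ p /\ ~ ABS p) /\
   (exists p : min_problem R d, ABS p /\ ~ BREQ p)) /\
  ((exists p : min_problem R d, BREQ p /\ ~ BND p) /\
   (exists p : min_problem R d, BND p /\ ~ BREQ p)) /\
  ((exists p : min_problem R d, SG1 p /\ ~ BND p) /\
   (exists p : min_problem R d, BND p /\ ~ SG1 p)) /\
  ((exists p : min_problem R d, ABS p /\ ~ FSML p) /\
   (exists p : min_problem R d, FSML p /\ ~ ABS p)).
Proof.
(* Positive dimension provides a basis vector, the unit vector [e] of the examples. *)
have e1 := @dotp_delta R d (Ordinal hd).
split; [split|split; [split|split; [split|split; [split|split; split]]]].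
- exists (masked R d); split; [exact: CON_masked|exact: not_ABS_masked e1].
- by eexists; split; [exact: ABS_shifted e1|exact: not_CON_shifted].
- exists (masked R d); split; [exact: CON_masked|exact: not_BREQ_masked e1].
- exists (tripled R d); split; [exact: BREQ_tripled|exact: not_CON_tripled e1].
- exists (tripled R d); split; [exact: BREQ_tripled|exact: not_ABS_tripled e1].
- by eexists; split; [exact: ABS_shifted e1|exact: not_BREQ_shifted].
- exists (tripled R d); split; [exact: BREQ_tripled|exact: not_BND_tripled e1].
- by eexists; split; [exact: BND_shifted e1|exact: not_BREQ_shifted].
- exists (tripled R d); split; [exact: SG1_tripled|exact: not_BND_tripled e1].
- by eexists; split; [exact: BND_shifted e1|exact: not_SG1_shifted].
- by eexists; split; [exact: ABS_shifted e1|exact: not_FSML_shifted].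
- exists (tripled R d); split; [exact: FSML_tripled|exact: not_ABS_tripled e1].
Qed.
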